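(* For every integer $h \ge 2$ there exists a set $A$ of positive integers which is simultaneously an asymptotic basis of order $2h$ and a $B_h[1]$-set.
   Context: For a set $A$ of positive integers and integers $k\ge 1$, $n \ge 0$, let $R_{k,A}(n)$ denote the number of solutions of $a_1 + a_2 + \dots + a_k = n$ with $a_1,\dots,a_k \in A$ and $a_1 \le a_2 \le \dots \le a_k$. A set $A$ is an asymptotic basis of order $k$ if there is $n_0$ such that $R_{k,A}(n) > 0$ for all $n > n_0$. A set $A$ is a $B_h[g]$-set if $R_{h,A}(n) \le g$ for every $n \ge 0$. *)

(* Defs.v *)
From mathcomp Require Import all_boot.
Set Implicit Arguments. Unset Strict Implicit. Unset Printing Implicit Defensive.

(* R_{k,A}(n): number of k-tuples (a_1,...,a_k) with a_i in A,
   a_1 <= ... <= a_k and a_1 + ... + a_k = n.  Every such a_i satisfies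
   a_i <= n, so enumerating tuples over 'I_n.+1 loses no solution. *)
Definition R (k : nat) (A : nat -> bool) (n : nat) : nat :=
  #|[set t : k.-tuple 'I_n.+1 |
       [&& sorted leq (map val t), all (fun x => A (val x)) t
         & sumn (map val t) == n]]|.

Definition positive_set (A : nat -> bool) : Prop := forall a, A a -> 0 < a.

Definition asymptotic_basis (k : nat) (A : nat -> bool) : Prop :=
  exists n0, forall n, n0 < n -> 0 < R k A n.

Definition Bhg_set (h g : nat) (A : nat -> bool) : Prop :=
  forall n, R h A n <= g.

(* Main.v *)
(** A greedy construction. Put r = 2h - 1. The set is built in stages; stage m,
    with m growing geometrically, extends a finite B_h[1]-set A with |A| << m so
    that every n in (C m^r, C (D m)^r] becomes a sum of 2h elements.

    First r m elements, all at most X = c m^r, are added one at a time so that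
    some set T of r-fold sums of the new elements has |T| >= m^r / 2^r: an
    averaging argument makes at least half of each new translate disjoint from
    the previous ones, and only O(m^r) values are forbidden by the B_h condition.

    Then O(log m) elements b > h X are added so that the translates b + T cover
    the target interval. If U is the uncovered part, an average b covers a
    constant fraction of U, since |T| is a constant fraction of the length of
    the interval. Because b > h X, a forbidden b must satisfy an equation
    k b + s = t involving an element from outside the batch behind T; such
    elements are few, so there are at most |T| / 2 forbidden values, and these
    account for at most half of the average. Hence some admissible b covers a
    constant fraction of U, and U is exhausted after logarithmically many steps.
*)

Require Import Defs.
From Stdlib Require Import ClassicalEpsilon.
From mathcomp Require Import all_boot zify.
Set Implicit Arguments. Unset Strict Implicit. Unset Printing Implicit Defensive.

(** * Finite B_h[1]-sets as lists, and adjoining one element *)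

Definition Bh (h : nat) (A : seq nat) : Prop :=
  forall s t : seq nat, size s = h -> size t = h ->
  {subset s <= A} -> {subset t <= A} -> sumn s = sumn t -> perm_eq s t.

Lemma Bh_nil h : 0 < h -> Bh h [::].
Proof.
move=> h_gt0 [|x s] t //= size_s _ sub_s; first by rewrite -size_s in h_gt0.
by have := sub_s x (mem_head _ _).
Qed.

(** Copies of a single element of [A] pad both sides to length [h]. *)
Lemma Bh_leq h A s t : Bh h A -> size s = size t -> size s <= h ->
  {subset s <= A} -> {subset t <= A} -> sumn s = sumn t -> perm_eq s t.
Proof.
move=> BA; case: s => [|x s]; first by case: t.
move=> eq_size le_h sub_s sub_t eq_sum.
have Ax : x \in A by apply: sub_s; rewrite mem_head.
have pad r : {subset r <= A} -> {subset nseq (h - size (x :: s)) x ++ r <= A}.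
  by move=> sub_r y; rewrite mem_cat mem_nseq => /orP [/andP[_ /eqP->]|/sub_r].
rewrite -(perm_cat2l (nseq (h - size (x :: s)) x)).
apply: BA; rewrite ?size_cat ?size_nseq -?eq_size ?subnK //; try exact: pad.
by rewrite !sumn_cat eq_sum.
Qed.

Lemma perm_nseq_cat b A (s : seq nat) : {subset s <= b :: A} ->
  exists k r, perm_eq s (nseq k b ++ r) /\ {subset r <= A}.
Proof.
move=> sub_s; exists (size (filter (pred1 b) s)), (filter (predC1 b) s).
split.
  have /all_pred1P <- := filter_all (pred1 b) s.
  by rewrite perm_sym (perm_filterC (pred1 b)).
move=> x; rewrite mem_filter /= => /andP[neq_xb /sub_s].
by rewrite inE (negPf neq_xb).
Qed.

(** Cancelling the copies of [b] common to two equal sums leaves [k * b] on one side, next to at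
    most [h.-1] other summands; zeros pad both sides to fixed lengths. If the multiplicities of [b]
    agree, [Bh_leq] applies to the rest. *)
Lemma Bh_cons h A b : Bh h A ->
  (forall k s t, 0 < k <= h -> size s = h.-1 -> size t = h ->
     {subset s <= 0 :: A} -> {subset t <= 0 :: A} ->
     k * b + sumn s <> sumn t) ->
  Bh h (b :: A).
Proof.
move=> BA freeb s t size_s size_t sub_s sub_t eq_sum.
have [k [r [perm_s sub_r]]] := perm_nseq_cat sub_s.
have [l [u [perm_t sub_u]]] := perm_nseq_cat sub_t.
have := perm_size perm_s; have := perm_size perm_t.
rewrite !size_cat !size_nseq size_s size_t => hl hk.
have := eq_sum; rewrite (perm_sumn perm_s) (perm_sumn perm_t).
rewrite !sumn_cat !sumn_nseq => eq_kl.
rewrite (permPl perm_s) perm_sym (permPl perm_t) perm_sym.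
have pad n v : {subset v <= A} -> {subset nseq n 0 ++ v <= 0 :: A}.
  move=> sub_v x; rewrite mem_cat mem_nseq inE.
  by case/orP => [/andP[_ ->]//|/sub_v ->]; rewrite orbT.
have impossible i j v w : h = i + size v -> h = j + size w -> j < i ->
    {subset v <= A} -> {subset w <= A} -> b * i + sumn v <> b * j + sumn w.
  move=> hi hj lt_ji sub_v sub_w eq_ij.
  apply: (freeb (i - j) (nseq i.-1 0 ++ v) (nseq j 0 ++ w)).
  - by lia.
  - by rewrite size_cat size_nseq; lia.
  - by rewrite size_cat size_nseq.
  - exact: pad.
  - exact: pad.
  - by rewrite !sumn_cat !sumn_nseq; nia.
case: (ltngtP k l) => [lt_kl | lt_lk | eq_k_l].
- by case: (impossible _ _ _ _ hl hk lt_kl sub_u sub_r).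
- by case: (impossible _ _ _ _ hk hl lt_lk sub_r sub_u).
- rewrite -eq_k_l perm_cat2l; apply: (Bh_leq BA) => //; lia.
Qed.

(** * Iterated sumsets and obstructing equations *)

Fixpoint sums (j : nat) (A : seq nat) : seq nat :=
  if j is i.+1 then [seq a + s | a <- A, s <- sums i A] else [:: 0].

Lemma size_sums j A : size (sums j A) = size A ^ j.
Proof. by elim: j => //= j IH; rewrite size_allpairs IH expnS. Qed.

Lemma sumsP j A n : reflect
  (exists s, [/\ size s = j, {subset s <= A} & sumn s = n]) (n \in sums j A).
Proof.
elim: j n => [|j IH] n /=.
  rewrite inE; apply: (iffP eqP) => [->|[s [/size0nil-> _ <-]]//].
  by exists [::].
apply: (iffP allpairsP) => [[[a m] /= [Aa /IH[s [<- sub_s <-]] ->]]|].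
  by exists (a :: s); split=> // x; rewrite inE => /predU1P[->|/sub_s].
case=> -[|a s] [] // [size_s] sub_s <-; exists (a, sumn s); split=> //=.
  by apply: sub_s; rewrite mem_head.
by apply/IH; exists s; split=> // x sx; apply: sub_s; rewrite inE sx orbT.
Qed.

Lemma sums_sub j A A' : {subset A <= A'} -> {subset sums j A <= sums j A'}.
Proof.
move=> subA n /sumsP[s [size_s sub_s <-]]; apply/sumsP; exists s.
by split=> // x /sub_s/subA.
Qed.

Lemma sums_leq j A X n : (forall a, a \in A -> a <= X) -> n \in sums j A ->
  n <= j * X.
Proof.
move=> leA /sumsP[s [<- sub_s <-]].
elim: s sub_s => //= a s IH sub_s; rewrite mulSn leq_add //.
  by apply/leA/sub_s; rewrite mem_head.
by apply: IH => x sx; apply: sub_s; rewrite inE sx orbT.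
Qed.

(* Since sums do not depend on the order, a summand taken in [E] can be
   put first. *)
Definition sums_hit (j : nat) (E W : seq nat) : seq nat :=
  [seq e + s | e <- E, s <- sums j.-1 (E ++ W)].

Lemma sums_hitP j E W s : size s = j -> {subset s <= E ++ W} ->
  sumn s \in sums_hit j E W \/ {subset s <= W}.
Proof.
move=> size_s sub_s; case: (boolP (has (mem E) s)) => [/hasP[e se Ee]|/hasPn nE].
  left; rewrite (perm_sumn (perm_to_rem se)) /=; apply/allpairsP.
  exists (e, sumn (rem e s)); split=> //=; apply/sumsP; exists (rem e s).
  by split=> [||//]; [rewrite size_rem // size_s | move=> x /mem_rem/sub_s].
right=> x sx; have := sub_s x sx; rewrite mem_cat.
by have /= /negPf-> := nE x sx.
Qed.

(* If all of [W] lies below [X] and [b > h X], an equation obstructing the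
   addition of [b] must use some element of [E]; this bounds the number of
   obstructions by |E| rather than |W| to the first power. The element 0 pads
   equations with fewer than [h] summands on a side. *)
Lemma obstructions h E W : 1 < h -> 0 \in E ->
  exists F : seq nat,
    size F <= 2 * h * size E * (size E + size W) ^ (2 * h - 2) /\
    forall A X b, {subset A <= E ++ W} -> (forall w, w \in W -> w <= X) ->
      h * X < b -> b \notin F -> Bh h A -> Bh h (b :: A).
Proof.
move=> h_gt1 E0; pose V := E ++ W.
pose P := [seq (t, s) | t <- sums_hit h E W, s <- sums h.-1 V] ++
          [seq (t, s) | t <- sums h V, s <- sums_hit h.-1 E W].
exists [seq (p.1 - p.2) %/ k | k <- iota 1 h, p <- P]; split.
  rewrite size_allpairs size_iota size_cat !size_allpairs !size_sums size_cat.
  set e := size E; set v := e + _.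
  have -> : 2 * h - 2 = h.-1 + h.-1 by lia.
  have -> : v ^ h * (e * v ^ h.-1.-1) = e * v ^ h.-1 * v ^ h.-1.
    have [g ->] : exists g, h = g.+2 by exists (h - 2); lia.
    by rewrite /= !expnS; move: (v ^ g) => p; lia.
  rewrite expnD; move: (v ^ h.-1) => p; lia.
move=> A X b subA leW ltb nF BA; apply: Bh_cons => // k s t k_h size_s size_t.
move=> sub_s sub_t eq_kb.
have subV : {subset 0 :: A <= V}.
  by move=> x; rewrite inE => /predU1P[->|/subA//]; rewrite mem_cat E0.
have {}sub_s x : x \in s -> x \in V by move/sub_s/subV.
have {}sub_t x : x \in t -> x \in V by move/sub_t/subV.
case/negP: nF; suff Pts : (sumn t, sumn s) \in P.
  apply/allpairsP; exists (k, (sumn t, sumn s)); split=> //=.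
    by rewrite mem_iota; lia.
  by rewrite -eq_kb addnK mulKn //; lia.
rewrite mem_cat; case: (sums_hitP size_t sub_t) => [hit_t|subW].
  apply/orP; left; apply/allpairsP; exists (sumn t, sumn s); split=> //=.
  by apply/sumsP; exists s.
have : sumn t <= h * X by apply: (@sums_leq _ W) => //; apply/sumsP; exists t.
by nia.
Qed.

(** * Averaging over translates *)

Lemma size_filter_notin (I F : seq nat) :
  uniq I -> size I <= size F + size [seq b : nat <- I | b \notin F].
Proof.
move=> uniq_I; rewrite -(count_predC (mem F) I) [X in _ <= _ + X]size_filter leq_add2r.
rewrite -size_filter; apply: uniq_leq_size; first exact: filter_uniq.
by move=> x; rewrite mem_filter => /andP[].
Qed.

Definition overlap (b : nat) (S U : seq nat) : nat :=
  count (fun s => b + s \in U) S.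

Lemma sum_overlapE I S U :
  \sum_(b <- I) overlap b S U = \sum_(s <- S) count (fun b => b + s \in U) I.
Proof.
under eq_bigr do rewrite /overlap -sum1_count.
rewrite (exchange_big_dep xpredT) //=.
by apply: eq_bigr => s _; rewrite sum1_count.
Qed.

Lemma sum_const_seq (T : Type) (s : seq T) n : \sum_(x <- s) n = size s * n.
Proof. by rewrite big_const_seq count_predT iter_addn_0 mulnC. Qed.

(** Double counting: for fixed [s], translation by [s] injects the counted [b] into [U]. *)
Lemma sum_overlap_le I S U :
  uniq I -> \sum_(b <- I) overlap b S U <= size S * size U.
Proof.
move=> uniq_I; rewrite sum_overlapE -sum_const_seq; apply: leq_sum => s _.
rewrite -size_filter -(size_map (addn^~ s)); apply: uniq_leq_size.
  by rewrite map_inj_uniq ?filter_uniq //; apply: addIn.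
by move=> _ /mapP[b + ->]; rewrite mem_filter => /andP[].
Qed.

(** The reverse count: for fixed [s], the map from [u] to [u - s] injects [U] into the counted
    [b]. *)
Lemma sum_overlap_ge I S U : uniq U ->
  (forall u s, u \in U -> s \in S -> s <= u /\ u - s \in I) ->
  size S * size U <= \sum_(b <- I) overlap b S U.
Proof.
move=> uniq_U UI; rewrite sum_overlapE -sum_const_seq.
rewrite big_seq [leqRHS]big_seq; apply: leq_sum => s Ss.
rewrite -(size_map (subn^~ s)) -size_filter; apply: uniq_leq_size.
  rewrite map_inj_in_uniq // => u v /UI /(_ Ss)[su _] /UI /(_ Ss)[sv _].
  by lia.
move=> _ /mapP[u Uu ->]; have [su Ius] := UI _ _ Uu Ss.
by rewrite mem_filter subnK // Uu.
Qed.

Lemma overlap_leq b S U : uniq S -> overlap b S U <= size U.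
Proof.
move=> uniq_S; rewrite /overlap -size_filter -(size_map (addn b)).
apply: uniq_leq_size.
  by rewrite map_inj_uniq ?filter_uniq //; apply: addnI.
by move=> _ /mapP[s + ->]; rewrite mem_filter => /andP[].
Qed.

(** More than [2 * size U] candidates avoid [F], while their overlaps add up to at most
    [size S * size U]. *)
Lemma exists_low_overlap (F S U : seq nat) X : size F + 2 * size U < X ->
  exists b, [/\ 0 < b <= X, b \notin F & 2 * overlap b S U <= size S].
Proof.
move=> ltX; pose I : seq nat := iota 1 X; pose J : seq nat := [seq b : nat <- I | b \notin F].
have : has (fun b => 2 * overlap b S U <= size S) J.
  apply/hasPn => high.
  have := @sum_overlap_le J S U (filter_uniq _ (iota_uniq _ _)).
  have : \sum_(b <- J) (size S).+1 <= 2 * \sum_(b <- J) overlap b S U.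
    rewrite big_distrr big_seq [leqRHS]big_seq; apply: leq_sum => b /high.
    by rewrite -ltnNge.
  rewrite sum_const_seq.
  have := @size_filter_notin I F (iota_uniq _ _); rewrite size_iota -/J => leX.
  have leJ : (2 * size U).+1 <= size J by lia.
  have := leq_mul leJ (leqnn (size S).+1).
  by move: (\sum_(b <- J) _) => x; lia.
case/hasP=> b; rewrite mem_filter mem_iota => /andP[nF /andP[b0 bX]] low.
by exists b; split=> //; lia.
Qed.

(* Every [u - t] is a legal value of [b], so the average overlap is
   |T||U| / N; the values in [F] account for at most |F||U| <= |T||U| / 2. *)
Lemma exists_high_overlap (F T U : seq nat) Y N q :
   uniq T -> uniq U -> 0 < size U -> 0 < N ->
  (forall u t, u \in U -> t \in T -> Y + t < u <= N) ->
  2 * size F <= size T -> 2 * N <= q * size T ->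
  exists b, [/\ Y < b, b \notin F & size U <= q * overlap b T U].
Proof.
move=> uniq_T uniq_U U_gt0 N_gt0 UT leF leN.
pose I : seq nat := iota Y.+1 N; pose J : seq nat := [seq b : nat <- I | b \notin F].
have uniq_I : uniq I := iota_uniq _ _.
have : has (fun b => size U <= q * overlap b T U) J.
  apply/hasPn => low.
  have sum_J : q * (\sum_(b <- J) overlap b T U) <= N * (size U).-1.
    have le_JN : size J <= N by rewrite size_filter (leq_trans (count_size _ _)) ?size_iota.
    apply: leq_trans (leq_mul le_JN (leqnn _)); rewrite -sum_const_seq.
    rewrite big_distrr big_seq [leqRHS]big_seq; apply: leq_sum => b /low.
    by rewrite -ltnNge -{1}(prednK U_gt0) ltnS.
  have sum_F : \sum_(b <- I | b \in F) overlap b T U <= size F * size U.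
    rewrite -big_filter; apply: leq_trans (_ : size [seq b <- I | b \in F] * size U <= _).
      by rewrite -sum_const_seq; apply: leq_sum => b _; apply: overlap_leq.
    rewrite leq_mul2r; apply/orP; right; apply: uniq_leq_size.
      exact: filter_uniq.
    by move=> x; rewrite mem_filter => /andP[].
  have : size T * size U <= \sum_(b <- I) overlap b T U.
    apply: sum_overlap_ge => // u t Uu Tt; have := UT _ _ Uu Tt.
    by rewrite mem_iota; lia.
  rewrite (bigID (mem F)) /= -[X in _ + X]big_filter -/J.
  move: (\sum_(i <- I | _) _) (\sum_(i <- J) _) sum_J sum_F => x y sum_J sum_F le_xy.
  have : q * (2 * x) <= q * (size T * size U) by rewrite leq_mul2l; apply/orP; right; nia.
  have : q * (2 * (size T * size U)) <= q * (2 * (x + y)).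
    by rewrite leq_mul2l; apply/orP; right; lia.
  have : 2 * N * size U <= q * size T * size U by rewrite leq_mul2r leN orbT.
  move: sum_J; rewrite -{2 3 4 5}(prednK U_gt0); move: (size U).-1 => u; lia.
case/hasP=> b; rewrite mem_filter mem_iota => /andP[nF /andP[b0 _]] high.
by exists b.
Qed.

(** * Spreading sums and covering an interval *)

(** Greedy choice of [W]: at most half of each new translate of [S] meets the union [S'] of the
    earlier ones. In the bound on [X], the first term covers the forbidden values and the second
    twice the size of [S']. *)
Lemma spread_step h (A S : seq nat) X i : 1 < h -> Bh h A -> uniq S ->
  2 * h * (size A + i).+1 ^ (2 * h - 1) + 2 * (i * size S) < X ->
  exists W S' : seq nat,
    [/\ size W = i, forall w, w \in W -> 0 < w <= X, Bh h (W ++ A),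
        uniq S' & {subset S' <= [seq w + s | w <- W, s <- S]}] /\
    size S' <= i * size S <= 2 * size S'.
Proof.
move=> h_gt1 BA uniq_S; elim: i => [|i IH] ltX; first by exists [::], [::].
have ltX' : 2 * h * (size A + i).+1 ^ (2 * h - 1) + 2 * (i * size S) < X.
  apply: leq_ltn_trans ltX; apply: leq_add; last by nia.
  by rewrite leq_mul2l leq_exp2r ?addnS ?leqnSn ?orbT //; lia.
have {IH ltX'}[W [S' [[size_W W_X BWA uniq_S' sub_S'] bnd]]] := IH ltX'.
have E0 : 0 \in 0 :: (W ++ A) by rewrite mem_head.
(* With all old elements placed in [E], the size condition of [obstructions] reduces to [0 < b]. *)
have [F [size_F addF]] := obstructions [::] h_gt1 E0.
have eqE : size (0 :: W ++ A) = (size A + i).+1.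
  by rewrite /= size_cat size_W addnC.
rewrite eqE addn0 -mulnA -expnS (_ : (2 * h - 2).+1 = 2 * h - 1) in size_F;
  last by lia.
have [|b [b_X nFb low]] := @exists_low_overlap F S S' X.
  apply: leq_ltn_trans ltX; apply: leq_add; last by nia.
  apply: leq_trans size_F _.
  by rewrite leq_mul2l leq_exp2r ?addnS ?leqnSn ?orbT //; lia.
exists (b :: W), ([seq b + s | s <- S & b + s \notin S'] ++ S').
split; last first.
  rewrite size_cat size_map size_filter.
  have := count_predC (fun s => b + s \in S') S.
  move: low; rewrite /overlap /predC /=.
  by move: (count _ S) (count _ S) => x y; lia.
split=> /=; first by rewrite size_W.
- by move=> w; rewrite inE => /predU1P[->|/W_X].
- apply: (addF _ 0) => //; last by rewrite muln0; case/andP: b_X.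
  by move=> x Wx; rewrite cats0 inE Wx orbT.
- rewrite cat_uniq uniq_S' map_inj_uniq ?filter_uniq //=; last exact: addnI.
  rewrite andbT; apply/hasPn => x S'x; apply/mapP=> -[s + eq_x].
  by rewrite mem_filter -eq_x S'x.
- move=> x; rewrite mem_cat => /orP[/mapP[s + ->]|/sub_S'].
    by rewrite mem_filter mem_cat => /andP[_ Ss]; rewrite map_f.
  by rewrite [in X in _ -> X]mem_cat => ->; rewrite orbT.
Qed.

(** Iterates [spread_step] with [m] fresh elements per round; each round multiplies the size of [T]
    by [m] up to a loss of a factor 2. *)
Lemma spread_phase h (A : seq nat) m X j : 1 < h -> Bh h A -> 0 < m ->
  2 * h * (size A + j * m).+1 ^ (2 * h - 1) + 2 * m ^ j < X ->
  exists W T : seq nat,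
    [/\ size W = j * m, forall w, w \in W -> 0 < w <= X, Bh h (W ++ A),
        uniq T & {subset T <= sums j W}] /\
    size T <= m ^ j <= 2 ^ j * size T.
Proof.
move=> h_gt1 BA m_gt0; elim: j => [|j IH] ltX.
  by exists [::], [:: 0]; split; [split | rewrite !expn0].
have [|W [T [[size_W W_X BWA uniq_T sub_T] /andP[leT geT]]]] := IH.
  apply: leq_ltn_trans ltX; apply: leq_add.
    by rewrite leq_mul2l leq_exp2r ?mulSn; lia.
  by rewrite leq_mul2l expnS leq_pmull.
have [|V [S [[size_V V_X BVWA uniq_S sub_S] /andP[leS geS]]]] :=
    @spread_step h (W ++ A) T X m h_gt1 BWA uniq_T.
  apply: leq_ltn_trans ltX; apply: leq_add.
    by rewrite leq_mul2l leq_exp2r ?size_cat ?size_W ?mulSn; lia.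
  by rewrite leq_mul2l expnS leq_mul2l leT !orbT.
exists (V ++ W), S; split; last first.
  rewrite !expnS (leq_trans leS) ?leq_mul2l ?leT ?orbT //=.
  have := leq_mul (leqnn m) geT; have := leq_mul (leqnn (2 ^ j)) geS; lia.
split=> //; first by rewrite size_cat size_V size_W mulSn.
- by move=> w; rewrite mem_cat => /orP[/V_X|/W_X].
- by rewrite -catA.
- move=> x /sub_S/allpairsP[[v t] /= [Vv /sub_T Tt ->]].
  apply/allpairsP; exists (v, t); split=> //=; first by rewrite mem_cat Vv.
  by apply: sums_sub Tt => y Wy; rewrite mem_cat Wy orbT.
Qed.

(** Each added [b] removes at least a fraction 1/[q] of the uncovered part. Obstructions are counted
    with [E] made of 0, [B] and [A], so that its size stays at most [e]. *)
Lemma cover_phase h (A W T U : seq nat) X q N e M :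
  1 < h -> Bh h (W ++ A) -> (forall w, w \in W -> w <= X) ->
  uniq T -> uniq U -> 0 < N ->
  (forall u t, u \in U -> t \in T -> h * X + t < u <= N) ->
  2 * (2 * h * e * (e + size W) ^ (2 * h - 2)) <= size T ->
  2 * N <= q * size T -> (size A + M).+1 <= e ->
  exists B U' : seq nat,
    [/\ size B <= M, forall b, b \in B -> 0 < b, Bh h (B ++ W ++ A),
        uniq U' & {subset U' <= U}] /\
    (forall u, u \in U -> u \notin U' -> u \in [seq b + t | b <- B, t <- T]) /\
    q ^ M * size U' <= q.-1 ^ M * size U.
Proof.
move=> h_gt1 BWA leW uniq_T uniq_U N_gt0 UT leT leN.
elim: M => [|M IH] le_e.
  by exists [::], U; split; [split | split] => // u ->.
have [|B [U' [[size_B B_gt0 BBWA uniq_U' sub_U'] [cov leU']]]] := IH.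
  by apply: leq_trans le_e; rewrite addnS.
(* Once everything is covered no further element is added. *)
case: (posnP (size U')) => [/size0nil U'0 | U'_gt0].
  exists B, U'; split; first by split=> //; apply: leqW.
  by split=> //; rewrite U'0 muln0.
have E0 : 0 \in 0 :: (B ++ A) by rewrite mem_head.
have [F [size_F addF]] := obstructions W h_gt1 E0.
have leE : size (0 :: B ++ A) <= e by rewrite /= size_cat; lia.
have leF : 2 * size F <= size T.
  apply: leq_trans leT; rewrite leq_mul2l (leq_trans size_F) //.
  apply: leq_mul; first by rewrite leq_mul2l leE orbT.
  by rewrite leq_exp2r ?leq_add2r //; lia.
have UT' u t : u \in U' -> t \in T -> h * X + t < u <= N by move/sub_U'/UT; apply.
have [b [ltb nFb high]] :=
  exists_high_overlap uniq_T uniq_U' U'_gt0 N_gt0 UT' leF leN.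
exists (b :: B), [seq u <- U' | u \notin [seq b + t | t <- T]].
split; last split.
- split=> /=; first by [].
  + by move=> c; rewrite inE => /predU1P[->|/B_gt0 //]; lia.
  + apply: (addF _ X) => // x; rewrite inE !mem_cat.
    by case/or3P=> ->; rewrite ?orbT.
  + exact: filter_uniq.
  + by move=> u; rewrite mem_filter => /andP[_ /sub_U'].
- move=> u Uu; rewrite mem_filter negb_and negbK.
  case/orP=> [/mapP[t Tt ->]|nU'].
    by rewrite /= mem_cat map_f.
  by rewrite /= mem_cat (cov u Uu nU') orbT.
- have le_ov : overlap b T U' <= count (mem [seq b + t | t <- T]) U'.
    rewrite /overlap -size_filter -(size_map (addn b)) -[leqRHS]size_filter.
    apply: uniq_leq_size.
      by rewrite map_inj_uniq ?filter_uniq //; apply: addnI.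
    move=> _ /mapP[t + ->]; rewrite !mem_filter => /andP[U'bt Tt].
    by rewrite U'bt andbT /=; apply/mapP; exists t.
  have dec : q * size [seq u <- U' | u \notin [seq b + t | t <- T]]
      <= q.-1 * size U'.
    rewrite size_filter.
    have := count_predC (mem [seq b + t | t <- T]) U'; rewrite /predC /=.
    move: le_ov high; move: (overlap _ _ _) (count _ U') (count _ U') => x y z.
    move: (size U') => u le_xz le_u eq_u.
    have := leq_mul (leqnn q) le_xz; rewrite -subn1 mulnBl mul1n; lia.
  rewrite !expnSr -mulnA.
  apply: leq_trans (leq_mul (leqnn _) dec) _.
  by rewrite mulnCA mulnAC [leqRHS]mulnC leq_mul2l leU' orbT.
Qed.

(** * Growth estimates *)

(** The ([r.+1])-st power of [L.+1] is already at most a constant times [2 ^ L]; the spare factor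
    [L.+1] absorbs the constants. *)
Lemma poly_lt_exp2 C r : exists L0, forall L, L0 <= L -> C * L.+1 ^ r < 2 ^ L.
Proof.
exists (C * r.+1 ^ r.+1) => L leL.
have le_exp : L.+1 ^ r.+1 <= r.+1 ^ r.+1 * 2 ^ L.
  have lt_L : L.+1 <= r.+1 * 2 ^ (L %/ r.+1).
    apply: leq_trans (ltn_ceil L (ltn0Sn r)) _.
    by rewrite mulnC leq_mul2l ltn_expl.
  apply: leq_trans (_ : (r.+1 * 2 ^ (L %/ r.+1)) ^ r.+1 <= _).
    by rewrite leq_exp2r.
  by rewrite expnMn -expnM leq_mul2l leq_exp2l // leq_trunc_div orbT.
rewrite -(ltn_pmul2r (ltn0Sn L)) -mulnA -expnSr.
apply: leq_ltn_trans (leq_mul (leqnn C) le_exp) _.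
by rewrite mulnA mulnC ltn_pmul2l // expn_gt0.
Qed.

(** Bernoulli's inequality for (1 + 1/p)^n with p = [q.-1] and n = [q]. It makes [q] covering steps
    halve the uncovered part. *)
Lemma double_pred_exp q : 0 < q -> 2 * q.-1 ^ q <= q ^ q.
Proof.
case: q => // p _; rewrite [p.+1.-1]/=.
have bernoulli n : p ^ n * (p + n) <= p.+1 ^ n * p.
  elim: n => [|n IH]; first by rewrite addn0.
  rewrite !expnS -mulnA [leqRHS]mulnAC; nia.
case: (posnP p) => [->|p_gt0]; first by rewrite exp0n.
by rewrite -(leq_pmul2r p_gt0); apply: leq_trans (bernoulli _); nia.
Qed.

(** * One stage of the construction *)

Lemma extension_step h : 1 < h ->
  exists C D K m0, [/\ 0 < C, 1 < D, 0 < m0 & forall m (A : seq nat),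
    m0 <= m -> Bh h A -> (forall a, a \in A -> 0 < a) -> K * size A <= m ->
    exists A' : seq nat,
      [/\ {subset A <= A'}, Bh h A', forall a, a \in A' -> 0 < a,
          K * size A' <= D * m &
          forall n, C * m ^ (2 * h - 1) < n <= C * (D * m) ^ (2 * h - 1) ->
            n \in sums (2 * h) A']].
Proof.
move=> h_gt1; have [r def_r] : exists r, r = 2 * h - 1 by eexists.
have r_S : r.+1 = 2 * h by rewrite def_r; lia.
(* [c1] makes X = [c1 * m ^ r] large enough for [spread_phase]. With [C] as below, [C * m ^ r] is
   3hX, which is at least hX + rX, so targets exceed hX plus any element of [T]. *)
have [c1 def_c1] : exists c, c = 2 * h * (2 * h).+1 ^ r + 3 by eexists.
have [C def_C] : exists C, C = 3 * h * c1 by eexists.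
(* Chosen so that [c2 * e <= m] keeps the forbidden values in [cover_phase] below half of
   [size T]. *)
have [c2 def_c2] : exists c, c = 2 ^ r * (4 * h * (2 * h) ^ (2 * h - 2)).
  by eexists.
have [K def_K] : exists K, K = 2 * c2 by eexists.
(* The new set will have at most [2 * h * m] elements. *)
have [D def_D] : exists D, D = 2 * h * K by eexists.
have [q def_q] : exists q, q = 2 * (C * D ^ r * 2 ^ r) by eexists.
(* With L = m / k this gives K(qL + 1) <= m; added to [K * size A <= m], it yields [c2 * e <= m]. *)
have [k def_k] : exists k, k = K * q.+1 by eexists.
have r_gt0 : 0 < r by rewrite def_r; lia.
have C_gt0 : 0 < C by rewrite def_C def_c1 !muln_gt0 addn_gt0 orbT andbT; lia.
have c2_gt0 : 0 < c2 by rewrite def_c2 !muln_gt0 !expn_gt0 muln_gt0; lia.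
have K_gt0 : 0 < K by rewrite def_K muln_gt0.
have D_gt1 : 1 < D by rewrite def_D; nia.
have q_gt1 : 1 < q.
  have : 0 < C * D ^ r * 2 ^ r by rewrite !muln_gt0 C_gt0 !expn_gt0 ltnW.
  by rewrite def_q; lia.
have k_gt0 : 0 < k by rewrite def_k muln_gt0 K_gt0.
have [L0 big_L0] := poly_lt_exp2 (C * D ^ r * k ^ r) r.
exists C, D, K, (k * L0.+1); split=> //; first by rewrite muln_gt0 k_gt0.
move=> m A le_m BA A_gt0 leA; rewrite -def_r.
have m_gt0 : 0 < m by apply: leq_trans le_m; rewrite muln_gt0 k_gt0.
have [L def_L] : exists L, L = m %/ k by eexists.
have [N def_N] : exists N, N = C * (D * m) ^ r by eexists.
have L_gt0 : L0 < L by rewrite def_L leq_divRL // mulnC.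
(* The budget of [q * L] covering elements is linear in [m], hence more than the logarithmic number
   required. *)
have lt_N : N < 2 ^ L.
  apply: leq_ltn_trans (big_L0 L (ltnW L_gt0)).
  rewrite def_N expnMn -!mulnA !leq_mul2l -expnMn leq_exp2r //.
  by rewrite def_L mulnC [X in _ <= X]mulnC mulnC ltnW ?orbT // ltn_ceil.
have [e def_e] : exists e, e = (size A + q * L).+1 by eexists.
have le_e : c2 * e <= m.
  have le_L : L * k <= m by rewrite def_L leq_trunc_div.
  have : K * (q * L).+1 <= L * k.
    by rewrite def_k mulnCA leq_mul2l mulnS (mulnC q) -add1n leq_add2r
      (leq_trans _ L_gt0) ?orbT.
  by move: leA le_L; rewrite def_e def_K; lia.
have le_em : e <= m by apply: leq_trans le_e; rewrite leq_pmull.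
have [X def_X] : exists X, X = c1 * m ^ r by eexists.
have ltX : 2 * h * (size A + r * m).+1 ^ (2 * h - 1) + 2 * m ^ r < X.
  rewrite -def_r.
  have : (size A + r * m).+1 ^ r <= ((2 * h).+1 * m) ^ r.
    rewrite leq_exp2r // def_r mulnBl (mul1n m) (mulSn (2 * h)).
    clear - le_em def_e; move: le_em; rewrite def_e; move: (2 * h * m) => y; lia.
  have : 0 < m ^ r by rewrite expn_gt0 m_gt0.
  rewrite expnMn => mr_gt0 le_r.
  apply: leq_ltn_trans (leq_add (leq_mul (leqnn _) le_r) (leqnn _)) _.
  by rewrite def_X def_c1 mulnDl !mulnA ltn_add2l ltn_pmul2r.
have [W [T [[size_W W_X BWA uniq_T sub_T] /andP[_ geT]]]] :=
  spread_phase h_gt1 BA m_gt0 ltX.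
have r_mul n : r * n + n = 2 * (h * n).
  by rewrite addnC -mulSn r_S mulnA.
have [U def_U] : exists U, U = iota (C * m ^ r).+1 (N - C * m ^ r) by eexists.
have N_gt0 : 0 < N by rewrite def_N muln_gt0 C_gt0 expn_gt0 muln_gt0 m_gt0 ltnW.
have leW w : w \in W -> w <= X by case/W_X/andP.
have UT u t : u \in U -> t \in T -> h * X + t < u <= N.
  rewrite def_U mem_iota => Uu /sub_T /(sums_leq leW) le_t.
  have eq_X : C * m ^ r = 3 * (h * X) by rewrite def_C def_X !mulnA.
  have := r_mul X; move: Uu le_t; rewrite eq_X.
  by move: (h * X) (r * X) => y z; clear; lia.
have leT : 2 * (2 * h * e * (e + size W) ^ (2 * h - 2)) <= size T.
  have le_W : (e + size W) ^ (2 * h - 2) <= (2 * h * m) ^ (2 * h - 2).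
    rewrite leq_exp2r ?size_W; last by clear - h_gt1; lia.
    by rewrite -mulnA -r_mul addnC leq_add2l.
  rewrite -(leq_pmul2l (m := 2 ^ r)) ?expn_gt0 //; apply: leq_trans geT.
  have -> : m ^ r = m ^ (2 * h - 2) * m.
    by rewrite -expnSr def_r; congr (_ ^ _); clear - h_gt1; lia.
  apply: leq_trans (leq_mul (leqnn (m ^ (2 * h - 2))) le_e).
  rewrite def_c2; move: le_W; rewrite expnMn.
  move: (2 ^ r) (_ ^ _) (_ ^ _) (_ ^ _) => x y z v le_y.
  by have := leq_mul (leqnn (x * (4 * h * e))) le_y; clear; lia.
have leN : 2 * N <= q * size T.
  by rewrite def_N def_q expnMn -!mulnA !leq_mul2l geT !orbT.
have le_B : (size A + q * L).+1 <= e by rewrite def_e.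
have uniq_U : uniq U by rewrite def_U iota_uniq.
have [B [U' [[size_B B_gt0 BBWA _ _] [cov leU']]]] :=
  cover_phase h_gt1 BWA leW uniq_T uniq_U N_gt0 UT leT leN le_B.
(* After [q * L] steps the uncovered part has size at most N / 2^L < 1. *)
have U'0 : U' = [::].
  apply/size0nil/eqP; rewrite -leqn0 leqNgt; apply/negP => U'_gt0.
  have leU : size U <= N by rewrite def_U size_iota leq_subr.
  have le_q : 2 ^ L * q.-1 ^ (q * L) <= q ^ (q * L).
    by rewrite !expnM -expnMn leq_exp2r ?double_pred_exp //
      ?(leq_trans _ L_gt0) // ltnW.
  have q1_gt0 : 0 < q.-1 ^ (q * L) by rewrite expn_gt0 ltn_predRL q_gt1.
  have lt_U : q.-1 ^ (q * L) * size U < 2 ^ L * q.-1 ^ (q * L).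
    by rewrite mulnC ltn_pmul2r // (leq_ltn_trans leU).
  have := leq_trans (leq_ltn_trans leU' lt_U) le_q.
  by rewrite ltnNge leq_pmulr.
exists (B ++ W ++ A); split=> //.
- by move=> a Aa; rewrite !mem_cat Aa !orbT.
- by move=> a; rewrite !mem_cat => /or3P[/B_gt0 | /W_X/andP[] | /A_gt0].
- rewrite !size_cat size_W def_D -(mulnA (2 * h)) mulnCA leq_mul2l -mulnA -r_mul.
  apply/orP; right; move: size_B le_em; rewrite def_e.
  by move: (r * m) (q * L) => x y; clear; lia.
- move=> n /andP[lt_n le_n].
  have /cov : n \in U.
    rewrite def_U mem_iota def_N; move: lt_n le_n.
    by move: (C * _) (C * _) => x y; clear; lia.
  rewrite U'0 => /(_ isT) /allpairsP[[b t] /= [Bb Tt ->]].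
  rewrite -r_S; apply/allpairsP; exists (b, t); split=> //=; first by rewrite mem_cat Bb.
  by apply: sums_sub (sub_T _ Tt) => w Ww; rewrite !mem_cat Ww orbT.
Qed.

(** * Dependent choice and the counting function *)

Lemma dependent_chain (T : Type) (P : nat -> T -> Prop)
    (Q : nat -> T -> T -> Prop) x0 :
  P 0 x0 -> (forall j x, P j x -> exists y, P j.+1 y /\ Q j x y) ->
  exists f : nat -> T, forall j, P j (f j) /\ Q j (f j) (f j.+1).
Proof.
move=> P0 step.
pose next j x := epsilon (inhabits x0) (fun y => P j.+1 y /\ Q j x y).
pose f := fix f j := if j is i.+1 then next i (f i) else x0.
have nextP j x : P j x -> P j.+1 (next j x) /\ Q j x (next j x).
  by move=> Px; apply: (epsilon_spec _ _ (step _ _ Px)).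
have Pf j : P j (f j) by elim: j => //= j /nextP[].
by exists f => j; split=> //; case: (nextP j (f j) (Pf j)).
Qed.

Lemma R_gt0 k (A : nat -> bool) (s : seq nat) :
  size s = k -> all A s -> 0 < R k A (sumn s).
Proof.
move=> size_s As; pose n := sumn s; pose u := sort leq s.
have perm_u : perm_eq u s by rewrite perm_sort.
have le_n x : x \in u -> x < n.+1.
  by rewrite mem_sort => sx; rewrite ltnS /n (perm_sumn (perm_to_rem sx)) leq_addr.
(* [inord] is faithful here, since no summand exceeds the total [n]. *)
have val_u : map val (map (@inord n) u) = u.
  by rewrite -map_comp map_id_in // => x /le_n; apply: inordK.
have size_u : size (map (@inord n) u) == k by rewrite size_map size_sort size_s.
rewrite /R -/n card_gt0; apply/set0Pn; exists (Tuple size_u).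
rewrite inE /= val_u sort_sorted; last exact: leq_total.
have -> : all (fun x : 'I_n.+1 => A (val x)) (map (@inord n) u) = all A u.
  by rewrite -[in RHS]val_u [RHS]all_map.
by rewrite (perm_all _ perm_u) As (perm_sumn perm_u) /=.
Qed.

(** A multiset has only one sorted arrangement. *)
Lemma R_leq1 k (A : nat -> bool) n :
  (forall s t, size s = k -> size t = k -> all A s -> all A t ->
     sumn s = sumn t -> perm_eq s t) ->
  R k A n <= 1.
Proof.
move=> BA; apply/card_le1_eqP => t u; rewrite !inE.
case/and3P=> [sorted_t At /eqP sum_t] /and3P[sorted_u Au /eqP sum_u].
apply/val_inj/(inj_map val_inj).
apply: (sorted_eq leq_trans anti_leq) => //.
by apply: BA; rewrite ?size_map ?size_tuple ?all_map // sum_t.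
Qed.

(** * The union of the stages *)

Theorem theorem1 : forall h : nat, 2 <= h ->
  exists A : nat -> bool,
    positive_set A /\ asymptotic_basis (2 * h) A /\ Bhg_set h 1 A.
Proof.
move=> h h_gt1; have [C [D [K [m0 [C_gt0 D_gt1 m0_gt0 step]]]]] := extension_step h_gt1.
(* Stage [j] runs with m = [m0 * D ^ j]; the intervals between consecutive [x j] then abut. *)
pose r := 2 * h - 1; pose x j := C * (m0 * D ^ j) ^ r.
pose P j (A : seq nat) := [/\ Bh h A, forall a, a \in A -> 0 < a &
  K * size A <= m0 * D ^ j].
pose Q j (A A' : seq nat) := {subset A <= A'} /\
  forall n, x j < n <= x j.+1 -> n \in sums (2 * h) A'.
have [||S chain] := @dependent_chain _ P Q [::].
- by split=> //; [apply/Bh_nil/ltnW | rewrite muln0].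
- move=> j A [BA A_gt0 leA].
  have le_m0 : m0 <= m0 * D ^ j by rewrite leq_pmulr // expn_gt0 ltnW.
  have [A' [subA BA' A'_gt0 leA' cov]] := step _ A le_m0 BA A_gt0 leA.
  have eqD : m0 * D ^ j.+1 = D * (m0 * D ^ j) by rewrite expnS mulnCA.
  by exists A'; rewrite /P /Q /x eqD.
have S_mono i j : i <= j -> {subset S i <= S j}.
  elim: j => [|j IH]; first by rewrite leqn0 => /eqP->.
  rewrite leq_eqVlt => /predU1P[->//|/IH sub_ij] a /sub_ij.
  by case: (chain j) => _ [+ _]; apply.
pose A a : bool := excluded_middle_informative (exists j, a \in S j).
have AP a : reflect (exists j, a \in S j) (A a) by apply: sumboolP.
have S_A j s : {subset s <= S j} -> all A s.
  by move=> sub_s; apply/allP => a /sub_s Sa; apply/AP; exists j.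
(* Finitely many elements lie in a common stage, so the B_h property passes to the union. *)
have A_S s : all A s -> exists j, {subset s <= S j}.
  elim: s => [|a s IH] /=; first by exists 0.
  case/andP=> /AP[i Sa] /IH[j sub_s]; exists (maxn i j) => b.
  rewrite inE => /predU1P[->|/sub_s].
    exact: S_mono (leq_maxl _ _) _ Sa.
  exact: S_mono (leq_maxr _ _) _.
exists A; split; [|split].
- by move=> a /AP[j Sa]; case: (chain j) => -[_ S_gt0 _] _; apply: S_gt0.
- exists (x 0) => n lt_n.
  have x_ge : exists j, n <= x j.
    exists n; apply: leq_trans (ltnW (ltn_expl n D_gt1)) _.
    apply: leq_trans (leq_pmull _ C_gt0); rewrite /r.
    rewrite -[X in X <= _]expn1 (leq_trans (_ : _ <= (m0 * D ^ n) ^ 1)) //.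
      by rewrite leq_exp2r // leq_pmull.
    by rewrite leq_pexp2l ?muln_gt0 ?m0_gt0 ?expn_gt0 ?(ltnW D_gt1) //; lia.
  (* The least index with [n <= x j] is positive because [n] exceeds [x 0]; its predecessor is the
     stage that covers [n]. *)
  case: (ex_minnP x_ge) => -[|j] le_n min_j; first by rewrite leqNgt lt_n in le_n.
  have lt_xj : x j < n by rewrite ltnNge; apply/negP => /min_j; rewrite ltnn.
  have [_ [_ /(_ n)]] := chain j; rewrite lt_xj le_n => /(_ isT).
  by case/sumsP=> s [size_s /S_A As <-]; apply: R_gt0.
- move=> n; apply: R_leq1 => s t size_s size_t As At eq_sum.
  have /A_S[j sub_j] : all A (s ++ t) by rewrite all_cat As At.
  have [[BS _ _] _] := chain j.
  by apply: BS => // a sa; apply: sub_j; rewrite mem_cat sa ?orbT.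
Qed.
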